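(* Let $0\le t<1$. Then $\|C_0\|_{cs\to cs}=1$ and $$\|C_t\|_{cs\to cs}=t^{-1}\log(1/(1-t)),\quad t\in(0,1).$$ The operator $C_t\in\mathcal{L}(cs)$ is compact and has spectra $$\sigma_{pt}(C_t;cs)=\Lambda\quad\text{and}\quad\sigma(C_t;cs)=\Lambda_0.$$ Moreover, $C_t$ is power bounded and uniformly mean ergodic in $cs$ but not supercyclic.
   Context: Sequences are complex and indexed by $\mathbb{N}_0=\{0,1,2,\dots\}$. $cs$ is the Banach space of all sequences $x$ for which $\sum_{n=0}^\infty x_n$ converges in $\mathbb{C}$, with norm $\|x\|_{cs}:=\sup_{n\in\mathbb{N}_0}\big|\sum_{k=0}^nx_k\big|$. For $t\in[0,1]$ the generalized Cesàro operator is $C_tx=\big(\frac{t^nx_0+t^{n-1}x_1+\dots+x_n}{n+1}\big)_{n\in\mathbb{N}_0}$, with $t^0=1$ also for $t=0$. $\Lambda:=\{\frac1{n+1}:n\in\mathbb{N}_0\}$ and $\Lambda_0:=\Lambda\cup\{0\}$. $\mathcal{L}(X)$ is the space of bounded linear operators on a Banach space $X$; $\sigma(T;X)$ and $\sigma_{pt}(T;X)$ are the spectrum and point spectrum (set of eigenvalues) of $T$. With $T_{[n]}:=\frac1n\sum_{m=1}^nT^m$, $T$ is uniformly mean ergodic if $(T_{[n]})_{n\geq 1}$ converges in operator norm; power bounded if $\sup_{n\ge1}\|T^n\|<\infty$; supercyclic if there is $x\in X$ with $\{\lambda T^nx:\lambda\in\mathbb{C},n\in\mathbb{N}_0\}$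 dense in $X$. *)

(* Defs.v *)
From HB Require Import structures.
From mathcomp Require Import all_boot all_order all_algebra.
From mathcomp Require Import complex.
From mathcomp Require Import all_classical all_reals all_analysis.

Set Implicit Arguments.
Unset Strict Implicit.
Unset Printing Implicit Defensive.

Import Order.TTheory GRing.Theory Num.Theory numFieldNormedType.Exports.

Local Open Scope classical_set_scope.
Local Open Scope ring_scope.
Local Open Scope complex_scope.

(* The norm of a normed module over R[i] is a nonnegative real number, but it
   has type R[i]; [rnorm] is the same number seen in R. *)
Definition rnorm (R : realType) (X : normedModType R[i]) (x : X) : R :=
  complex.Re `|x|.

Section rnorm_lemmas.
Context {R : realType} {X : normedModType R[i]}.
Implicit Types x y : X.

Lemma rnormE x : (rnorm x)%:C = `|x|.
Proof. by rewrite /rnorm RRe_real// ger0_real. Qed.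

Lemma rnorm_ge0 x : 0 <= rnorm x.
Proof. by rewrite -lecR rnormE normr_ge0. Qed.

Lemma ler_rnormD x y : rnorm (x + y) <= rnorm x + rnorm y.
Proof. by rewrite -lecR rmorphD/= !rnormE ler_normD. Qed.

Lemma rnormZ (a : R[i]) x : rnorm (a *: x) = complex.Re `|a| * rnorm x.
Proof.
by apply: complexI; rewrite rmorphM/= !rnormE normrZ.
Qed.

End rnorm_lemmas.

Section operators.
Context {R : realType} {X : normedModType R[i]}.
Implicit Types T S : X -> X.

Definition bounded_operator T : Prop :=
  linear T /\ exists M : R, forall x, rnorm (T x) <= M * rnorm x.

(* The real [sup] is 0 on unbounded sets: this is the operator norm only for a
   bounded operator T. *)
Definition opnorm T : R := sup [set rnorm (T x) | x in [set x | rnorm x <= 1]].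

Definition compact_operator T : Prop :=
  linear T /\ precompact (T @` [set x | rnorm x <= 1]).

Definition point_spectrum T : set R[i] :=
  [set lambda | exists2 x, x != 0 & T x = lambda *: x].

Definition spectrum T : set R[i] :=
  [set lambda | ~ exists S, [/\ bounded_operator S,
    forall x, S (lambda *: x - T x) = x &
    forall x, lambda *: S x - T (S x) = x]].

Definition power_bounded T : Prop :=
  has_ubound [set opnorm (iter n T) | n in [set n | (1 <= n)%N]].

(* The index n = 0, where the inverse is the junk value 0, is irrelevant to the
   limit below. *)
Definition ergodic_mean T (n : nat) : X -> X :=
  fun x => (n%:R : R[i])^-1 *: \sum_(1 <= m < n.+1) iter m T x.

Definition uniformly_mean_ergodic T : Prop :=
  exists2 P : X -> X, bounded_operator P &
    opnorm (fun x => ergodic_mean T n x - P x) @[n --> \oo] --> (0 : R).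

Definition supercyclic T : Prop :=
  exists x, dense
    [set lambda *: iter n T x | lambda in [set: R[i]] & n in [set: nat]].

End operators.

Section cs.
Context (R : realType).

(* R[i]^o is R[i] seen as a normed module over itself. *)
Definition cs_pred : {pred nat -> R[i]^o} :=
  [pred x : nat -> R[i]^o | `[< cvgn (series x) >]].

Record cs : Type := Cs { cs_val :> nat -> R[i]^o ; _ : cs_val \in cs_pred }.

HB.instance Definition _ := [isSub for cs_val].
HB.instance Definition _ := [Choice of cs by <:].

Lemma cs_submod_closed : submod_closed cs_pred.
Proof.
split=> [|a x y /asboolP cx /asboolP cy]; apply/asboolP.
  have -> : series (0 : nat -> R[i]^o) = cst 0; last exact: is_cvg_cst.
  by apply/funext => n; rewrite /series/= big1.
rewrite (_ : series _ = a *: series x + series y); last first.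
  apply/funext => n; rewrite /series/=.
  transitivity (\sum_(0 <= k < n) (a *: x k + y k)); first exact: eq_bigr.
  by rewrite big_split/= -scaler_sumr.
have cax := @is_cvgZl_tmp _ R[i]^o _ _ eventually_filter a _ cx.
exact (@is_cvgD _ R[i]^o _ _ eventually_filter _ _ cax cy).
Qed.

HB.instance Definition _ :=
  GRing.isSubmodClosed.Build _ _ cs_pred cs_submod_closed.
HB.instance Definition _ := [SubChoice_isSubLmodule of cs by <:].

Implicit Types x y : cs.

Definition csnorm x : R :=
  sup (range (fun n : nat => rnorm (\sum_(0 <= k < n.+1) cs_val x k))).

Lemma cs_cvg x : cvgn (series (cs_val x)).
Proof. by case: x => x /= /asboolP. Qed.

Lemma csnorm_has_sup x : has_sup
  (range (fun n : nat => rnorm (\sum_(0 <= k < n.+1) cs_val x k))).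
Proof.
split; first by exists (rnorm (\sum_(0 <= k < 1) cs_val x k)), 0%N.
have /pinfty_ex_gt0[M _ Mx] := @cvg_seq_bounded _ R[i]^o _ (@cs_cvg x).
exists (complex.Re M) => _ [n _ <-].
have : `|series (cs_val x) n.+1| <= M by exact: Mx.
by rewrite -rnormE lecE => /andP[].
Qed.

Lemma csnorm_ub x n :
  rnorm (\sum_(0 <= k < n.+1) cs_val x k) <= csnorm x.
Proof.
by apply: ub_le_sup; [case: (csnorm_has_sup x)|exists n].
Qed.

Lemma csnorm_le x (M : R) :
  (forall n, rnorm (\sum_(0 <= k < n.+1) cs_val x k) <= M) ->
  csnorm x <= M.
Proof.
move=> xM; apply: ge_sup; first by case: (csnorm_has_sup x).
by move=> _ [n _ <-].
Qed.

Lemma csnorm_ge0 x : 0 <= csnorm x.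
Proof. exact: le_trans (rnorm_ge0 _) (csnorm_ub x 0). Qed.

Lemma csnormD x y : csnorm (x + y) <= csnorm x + csnorm y.
Proof.
apply: csnorm_le => n; rewrite big_split/=.
by rewrite (le_trans (ler_rnormD _ _))// lerD// csnorm_ub.
Qed.

Lemma csnormZ_le (a : R[i]) x :
  csnorm (a *: x) <= complex.Re `|a| * csnorm x.
Proof.
apply: csnorm_le => n; rewrite -scaler_sumr rnormZ ler_wpM2l ?csnorm_ub//.
exact: (@rnorm_ge0 R R[i]^o a).
Qed.

Lemma csnormZ (a : R[i]) x : csnorm (a *: x) = complex.Re `|a| * csnorm x.
Proof.
apply/eqP; rewrite eq_le csnormZ_le andTb.
have [->|a0] := eqVneq a 0; first by rewrite normr0 mul0r csnorm_ge0.
have aE : (complex.Re `|a|)%:C = `|a| by exact: (@rnormE R R[i]^o a).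
have Na : 0 < complex.Re `|a| by rewrite -ltcR aE normr_gt0.
rewrite -ler_pdivlMl// (le_trans _ (_ : complex.Re `|a^-1| * csnorm (a *: x) <= _))//.
  by rewrite -{1}[x](scalerK a0) csnormZ_le.
by rewrite normfV -aE -fmorphV.
Qed.

Lemma csnorm_eq0 x : csnorm x = 0 -> x = 0.
Proof.
move=> x0; have S0 n : \sum_(0 <= k < n) cs_val x k = 0.
  case: n => [|n]; first by rewrite big_geq.
  apply/eqP; rewrite -normr_le0 -rnormE.
  by rewrite -(rmorph0 (real_complex R)) lecR -[leRHS]x0; exact: csnorm_ub.
apply/val_inj/funext => n /=.
by have := S0 n.+1; rewrite big_nat_recr//= S0 add0r.
Qed.

Let norm_cs x : R[i] := (csnorm x)%:C.

Let norm_csD x y : norm_cs (x + y) <= norm_cs x + norm_cs y.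
Proof. by rewrite /norm_cs -rmorphD lecR csnormD. Qed.

Let norm_csZ (a : R[i]) x : norm_cs (a *: x) = `|a| * norm_cs x.
Proof.
by rewrite /norm_cs csnormZ rmorphM/= (@rnormE R R[i]^o a).
Qed.

Let norm_cs0_eq0 x : norm_cs x = 0 -> x = 0.
Proof. by move=> /complexI /csnorm_eq0. Qed.

HB.instance Definition _ :=
  Lmodule_isNormed.Build R[i] cs norm_csD norm_csZ norm_cs0_eq0.

Lemma rnorm_csE x : rnorm x = csnorm x.
Proof. by []. Qed.

End cs.

(* 0 ^+ 0 = 1 in MathComp, which is the convention wanted at t = 0. *)
Definition gen_cesaro (R : realType) (t : R) (x : nat -> R[i]^o) : nat -> R[i]^o :=
  fun n => (n.+1%:R : R[i])^-1 *: \sum_(0 <= k < n.+1) t%:C ^+ (n - k) *: x k.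

Definition Lambda (R : realType) : set R[i] :=
  range (fun n : nat => (n.+1%:R : R[i])^-1).
Arguments Lambda R : clear implicits.

Definition Lambda0 (R : realType) : set R[i] := Lambda R `|` [set 0].
Arguments Lambda0 R : clear implicits.

(* Main.v *)
(* Everything is read on partial sums. For z = C_t x one has
   (n+1) z_n - t n z_(n-1) = x_n; in other words C_t = D (1 - tS)^-1 with S the
   right shift and D the multiplication by 1/(n+1). By Abel summation a bound A
   on the partial sums of x gives the bound A * sum_(j < p) t^j/(j+1) on the p-th
   partial sum of C_t x, which is attained at e_0 and yields the norm, and the
   bound 2A / ((1-t)(m+1)) on the tails past m, which yields compactness.
   The operator is lower triangular with diagonal entries 1/(n+1), so the
   eigenvalues are these entries, with eigenvectors t^(n-m) binomial(n, m). If
   l is neither 0 nor one of them, then l x - C_t x = y is solved recursively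
   and the smallness of the tails bounds x by a multiple of y.
   Splitting off the eigenvectors one at a time shows that C_t^n converges
   geometrically to the rank-one projection x |-> x_0 (t^k)_k, from which the
   dynamical properties follow. *)

Require Import Defs.
From mathcomp Require Import all_boot all_order all_algebra.
From mathcomp Require Import complex ring lra.
From mathcomp Require Import all_classical all_reals all_analysis.

Set Implicit Arguments.
Unset Strict Implicit.
Unset Printing Implicit Defensive.

Import Order.TTheory GRing.Theory Num.Theory numFieldNormedType.Exports.

Local Open Scope classical_set_scope.
Local Open Scope ring_scope.

(** * Norms and partial sums *)

Section rnorm_theory.
Context {R : realType} {X : normedModType R[i]}.
Local Open Scope complex_scope.
Implicit Types x y : X.

Lemma rnorm0 : rnorm (0 : X) = 0.
Proof. by rewrite /rnorm normr0. Qed.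

Lemma rnormN x : rnorm (- x) = rnorm x.
Proof. by rewrite /rnorm normrN. Qed.

Lemma ler_rnormB x y : rnorm (x - y) <= rnorm x + rnorm y.
Proof. by rewrite -(rnormN y) ler_rnormD. Qed.

Lemma rnorm_le0 x : rnorm x <= 0 -> x = 0.
Proof.
by move=> x0; apply/normr0_eq0/le_anti; rewrite normr_ge0 -rnormE lecR x0.
Qed.

Lemma rnorm_gt0 x : x != 0 -> 0 < rnorm x.
Proof.
by rewrite lt_neqAle rnorm_ge0 andbT eq_sym; apply: contra_neq => x0; rewrite (@rnorm_le0 x) ?x0.
Qed.

Lemma ler_rnorm_sum (I : Type) (r : seq I) (P : pred I) (F : I -> X) :
  rnorm (\sum_(i <- r | P i) F i) <= \sum_(i <- r | P i) rnorm (F i).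
Proof.
elim/big_rec2 : _ => [|i y x _ le_xy]; first by rewrite rnorm0.
by rewrite (le_trans (ler_rnormD _ _))// lerD2l.
Qed.

Lemma rnormZC (a : R) x : rnorm (a%:C *: x) = `|a| * rnorm x.
Proof. by rewrite rnormZ normc_def/= expr0n addr0 sqrtr_sqr. Qed.

Lemma cvg_rnormP {T : Type} {F : set_system T} {FF : Filter F} (f : T -> X) x :
  f @ F --> x <-> forall e : R, 0 < e -> \forall n \near F, rnorm (x - f n) < e.
Proof.
split=> [/cvgrPdist_lt fx e e0|fx].
  have := fx e%:C; rewrite ltcR => /(_ e0); apply: filterS => n.
  by rewrite -rnormE ltcR.
apply/cvgrPdist_lt => -[e i]; rewrite ltcE/= => /andP[/eqP -> e0].
by have := fx e e0; apply: filterS => n; rewrite -rnormE ltcR.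
Qed.

End rnorm_theory.

Section complex_norm.
Context {R : realType}.
Local Open Scope complex_scope.
Implicit Types a b : R[i].

Lemma scaleCE a (b : R[i]^o) : a *: b = a * b.
Proof. by []. Qed.

Lemma rnormM a b : rnorm (a * b : R[i]^o) = rnorm (a : R[i]^o) * rnorm (b : R[i]^o).
Proof. exact: (@rnormZ R R[i]^o). Qed.

Lemma rnormC (a : R) : rnorm (a%:C : R[i]^o) = `|a|.
Proof. by rewrite /rnorm normc_def/= expr0n addr0 sqrtr_sqr. Qed.

Lemma ler_rnorm_ReIm a : rnorm (a : R[i]^o) <= `|complex.Re a| + `|complex.Im a|.
Proof.
case: a => a b /=.
have -> : (a +i* b)%C = a%:C%C + 'i%C * b%:C%C by simpc.
rewrite (le_trans (ler_rnormD _ _))// rnormM !rnormC.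
by rewrite /rnorm normc_def/= expr0n expr1n add0r sqrtr1 mul1r.
Qed.

Lemma ler_Re_rnorm a : `|complex.Re a| <= rnorm (a : R[i]^o).
Proof.
case: a => a b; rewrite /rnorm normc_def/= -sqrtr_sqr ler_wsqrtr//.
by rewrite lerDl sqr_ge0.
Qed.

Lemma ler_Im_rnorm a : `|complex.Im a| <= rnorm (a : R[i]^o).
Proof.
case: a => a b; rewrite /rnorm normc_def/= -sqrtr_sqr ler_wsqrtr//.
by rewrite lerDr sqr_ge0.
Qed.

(** Completeness of the reals is applied to real and imaginary parts. The rate B/(m+1) is that of
    the tails of C_t x. *)
Lemma cvg_complex (u : nat -> R[i]^o) (B : R) :
  (forall m p, (m <= p)%N -> rnorm (u p - u m) <= B / m.+1%:R) -> cvgn u.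
Proof.
move=> uB.
have B_ge0 : 0 <= B.
  by have := le_trans (rnorm_ge0 _) (uB 0%N 0%N (leqnn _)); rewrite divr1.
have aux (v : nat -> R) :
    (forall m p, `|v p - v m| <= rnorm (u p - u m)) -> cvgn v.
  move=> vu; apply/cauchy_cvgP/cauchyP => e e0.
  have [m Bm] : exists m, B / m.+1%:R < e.
    exists (Num.truncn (B / e)).
    by rewrite ltr_pdivrMr// mulrC -ltr_pdivrMr// truncnS_gt.
  exists (v m); exists m => // p /= mp; rewrite /ball/= distrC.
  by rewrite (le_lt_trans (vu _ _))// (le_lt_trans (uB _ _ mp)).
have /cvg_ex[a ua] : cvgn (fun n => complex.Re (u n)).
  apply: aux => m p; rewrite (le_trans _ (ler_Re_rnorm _))//.
  by case: (u p) (u m) => [? ?] [? ?].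
have /cvg_ex[b ub] : cvgn (fun n => complex.Im (u n)).
  apply: aux => m p; rewrite (le_trans _ (ler_Im_rnorm _))//.
  by case: (u p) (u m) => [? ?] [? ?].
apply/cvg_ex; exists (a +i* b); apply/cvg_rnormP => e e0.
have e20 : 0 < e / 2 by rewrite divr_gt0.
move/cvgrPdist_lt : ua => /(_ _ e20); move/cvgrPdist_lt : ub => /(_ _ e20).
apply: filterS2 => n ub ua; rewrite [e]splitr.
rewrite (le_lt_trans (ler_rnorm_ReIm _))//.
by move: ua ub; case: (u n) => [? ?]; exact: ltrD.
Qed.

End complex_norm.

(** * Summation by parts *)

Section abel.
Context {R : realType} {X : normedModType R[i]}.
Local Open Scope complex_scope.
Implicit Types (d : nat -> R) (x : nat -> X).

(** Summation by parts turns the weights into d_k - d_(k+1) for k < N and d_N, all nonnegative and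
    with total d_0. *)
Lemma ler_rnorm_abel d x N A : (forall n, 0 <= d n) ->
  (forall n, d n.+1 <= d n) ->
  (forall n, (n <= N)%N -> rnorm (\sum_(0 <= k < n) x k) <= A) ->
  rnorm (\sum_(0 <= k < N) (d k)%:C *: x k) <= d 0%N * A.
Proof.
move=> d_ge0 d_le xA.
set s := fun n => \sum_(0 <= k < n) x k.
have sumE p : \sum_(0 <= k < p) (d k)%:C *: x k =
    \sum_(0 <= k < p) (d k - d k.+1)%:C *: s k.+1 + (d p)%:C *: s p.
  elim: p => [|p IHp]; first by rewrite !big_geq// add0r /s big_geq// scaler0.
  rewrite !big_nat_recr//= {}IHp -!addrA; congr (_ + _).
  rewrite rmorphB/= scalerBl subrK.
  by rewrite [s p.+1]big_nat_recr//= scalerDr.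
have telE p : \sum_(0 <= k < p) (d k - d k.+1) * A + d p * A = d 0%N * A.
  elim: p => [|p IHp]; first by rewrite big_geq// add0r.
  by rewrite big_nat_recr//= -addrA -mulrDl subrK.
rewrite sumE -(telE N) (le_trans (ler_rnormD _ _))// lerD//; last first.
  by rewrite rnormZC ger0_norm// ler_wpM2l ?xA.
rewrite (le_trans (ler_rnorm_sum _ _ _))// big_nat [leRHS]big_nat ler_sum//.
move=> k /= kN; have dk : 0 <= d k - d k.+1 by rewrite subr_ge0.
by rewrite rnormZC ger0_norm// ler_wpM2l ?xA.
Qed.

(** Partial sums started at m are differences of two partial sums of x, whence the factor 2. *)
Lemma ler_rnorm_abel_tail d x m p A : (forall n, 0 <= d n) ->
  (forall n, d n.+1 <= d n) ->
  (forall n, (n <= p)%N -> rnorm (\sum_(0 <= k < n) x k) <= A) ->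
  (m <= p)%N ->
  rnorm (\sum_(m <= k < p) (d k)%:C *: x k) <= 2 * d m * A.
Proof.
move=> d_ge0 d_le xA mp.
rewrite -{1}[m]add0n big_addn (mulrC 2) -mulrA -{2}[m]add0n.
apply: (@ler_rnorm_abel (fun k => d (k + m)%N) (fun k => x (k + m)%N)).
- by move=> k.
- by move=> k; rewrite addSn.
move=> n nN.
have -> : \sum_(0 <= k < n) x (k + m)%N =
    \sum_(0 <= k < n + m) x k - \sum_(0 <= k < m) x k.
  rewrite (@big_cat_nat _ _ _ m 0 (n + m))//= ?leq_addl// addrAC subrr add0r.
  by rewrite -{2}[m]add0n big_addn addnK.
rewrite (le_trans (ler_rnormB _ _))// mulrC mulr_natr mulr2n lerD ?xA//.
by rewrite addnC -leq_subRL.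
Qed.

End abel.

(** * Partial sums of C_t x *)

Section cesaro_sequence.
Context {R : realType}.
Local Open Scope complex_scope.
Variable t : R.
Hypotheses (t_ge0 : 0 <= t) (t_lt1 : t < 1).
Implicit Types (x y z : nat -> R[i]^o) (A : R).

(** This is (1 - tS)^-1 x with S the right shift: C_t x before division by n+1. *)
Let g x n : R[i]^o := \sum_(0 <= k < n.+1) t%:C ^+ (n - k) *: x k.

Let gS x n : g x n.+1 = t%:C *: g x n + x n.+1.
Proof.
rewrite /g big_nat_recr//= subnn expr0 scale1r; congr (_ + _).
rewrite scaler_sumr big_nat [RHS]big_nat; apply: eq_bigr => k /= kn.
by rewrite scalerA -exprS subSn.
Qed.

(** Through this recurrence eigenvectors and resolvent are checked without handling sums. *)
Lemma gen_cesaroP x z : z = gen_cesaro t x <->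
  z 0%N = x 0%N /\
  forall n, (n.+2%:R : R[i]) * z n.+1 =
    t%:C * ((n.+1%:R : R[i]) * z n) + x n.+1.
Proof.
have gE n : (n.+1%:R : R[i]) * gen_cesaro t x n = g x n.
  by rewrite /gen_cesaro -/(g x n) [X in _ * X]scaleCE mulrA mulfV ?mul1r// pnatr_eq0.
have g0 : g x 0%N = x 0%N by rewrite /g big_nat1 expr0 scale1r.
split=> [->|[z0 zS]].
  split=> [|n]; last by rewrite !gE gS.
  by rewrite -g0 -gE mul1r.
apply/funext => n.
suff : (n.+1%:R : R[i]) * z n = n.+1%:R * gen_cesaro t x n.
  by apply: mulfI; rewrite pnatr_eq0.
by rewrite gE; elim: n => [|n IHn]; rewrite ?mul1r ?g0// zS IHn gS.
Qed.

(** The partial sums G of g and s of x satisfy G_(n+1) = t G_n + s_(n+1), and A/(1-t) is the fixed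
    point of a |-> t a + A. *)
Let series_g x A p :
  (forall n, (n <= p)%N -> rnorm (\sum_(0 <= k < n) x k) <= A) ->
  rnorm (\sum_(0 <= k < p) g x k) <= A / (1 - t).
Proof.
move=> xA.
have A_ge0 : 0 <= A by rewrite (le_trans (rnorm_ge0 _) (xA 0%N _)).
have gE n : \sum_(0 <= k < n.+1) g x k =
    t%:C *: \sum_(0 <= k < n) g x k + \sum_(0 <= k < n.+1) x k.
  elim: n => [|n IHn].
    by rewrite [X in _ *: X]big_geq// !big_nat1 scaler0 add0r /g big_nat1 scale1r.
  rewrite [LHS]big_nat_recr//= [in LHS]IHn gS addrACA -scalerDr.
  by congr (_ *: _ + _); rewrite [RHS]big_nat_recr.
have t1 : 0 < 1 - t by rewrite subr_gt0.
elim: p xA => [|p IHp] xA; first by rewrite big_geq// rnorm0 divr_ge0// ltW.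
rewrite gE (le_trans (ler_rnormD _ _))//.
have -> : A / (1 - t) = t * (A / (1 - t)) + A by field; rewrite gt_eqF.
rewrite lerD ?xA// rnormZC ger0_norm// ler_wpM2l// IHp// => n np.
by rewrite xA// (leq_trans np).
Qed.

(* Dirichlet's test: C_t = D (1 - tS)^-1, where S is the right shift, which
   does not increase bounds on partial sums, and D is the multiplication by the
   decreasing sequence 1/(n+1). *)
Lemma gen_cesaro_tail x m p A :
  (forall n, (n <= p)%N -> rnorm (\sum_(0 <= k < n) x k) <= A) ->
  (m <= p)%N ->
  rnorm (\sum_(m <= k < p) gen_cesaro t x k) <= 2 * A / (1 - t) / m.+1%:R.
Proof.
move=> xA mp.
have -> : \sum_(m <= k < p) gen_cesaro t x k =
    \sum_(m <= k < p) (k.+1%:R^-1 : R)%:C *: g x k.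
  by apply: eq_bigr => k _; rewrite fmorphV/= rmorph_nat.
rewrite (_ : 2 * A / _ / _ = 2 * (m.+1%:R^-1) * (A / (1 - t))); last first.
  by rewrite -!mulrA; congr (_ * _); rewrite mulrA mulrC.
apply: (@ler_rnorm_abel_tail _ _ (fun k => k.+1%:R^-1)) => // [n|n np].
  by rewrite lef_pV2 ?posrE// ler_nat.
by apply: series_g => k kn; rewrite xA// (leq_trans kn).
Qed.

Lemma gen_cesaro_le x p A :
  (forall n, (n <= p)%N -> rnorm (\sum_(0 <= k < n) x k) <= A) ->
  rnorm (\sum_(0 <= k < p) gen_cesaro t x k) <=
    (\sum_(0 <= j < p) t ^+ j / j.+1%:R) * A.
Proof.
move=> xA.
(* The coefficient of x_k in the p-th partial sum of C_t x; it decreases in k, so Abel's bound is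
   a_0 A. *)
pose a k : R := \sum_(0 <= j < p - k) t ^+ j / (j + k).+1%:R.
have -> : \sum_(0 <= k < p) gen_cesaro t x k = \sum_(0 <= k < p) (a k)%:C *: x k.
  rewrite {}/a; elim: p {xA} => [|p IHp]; first by rewrite !big_geq.
  rewrite big_nat_recr//= {}IHp /gen_cesaro scaler_sumr.
  pose b k : R := \sum_(0 <= j < p - k) t ^+ j / (j + k).+1%:R.
  transitivity (\sum_(0 <= k < p.+1)
      ((b k)%:C *: x k + p.+1%:R^-1 *: (t%:C ^+ (p - k) *: x k))).
    rewrite big_split/=; congr (_ + _).
    have bp : b p = 0 by rewrite /b subnn big_geq.
    by rewrite [RHS]big_nat_recr//= bp scale0r addr0.
  rewrite [LHS]big_nat [RHS]big_nat; apply: eq_bigr => k /=; rewrite ltnS => kp.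
  rewrite subSn// [in RHS]big_nat_recr//= subnK// rmorphD scalerDl/=.
  by rewrite rmorphM/= rmorphXn/= fmorphV/= rmorph_nat scalerA mulrC.
have a0 : a 0%N = \sum_(0 <= j < p) t ^+ j / j.+1%:R.
  by rewrite /a subn0; apply: eq_bigr => j _; rewrite addn0.
rewrite -a0; apply: ler_rnorm_abel => // n.
  by apply: sumr_ge0 => j _; rewrite divr_ge0// exprn_ge0.
apply: (@le_trans _ _ (\sum_(0 <= j < p - n.+1) t ^+ j / (j + n).+1%:R)).
  apply: ler_sum => j _; rewrite ler_wpM2l ?exprn_ge0//.
  by rewrite lef_pV2 ?posrE// ler_nat addnS.
rewrite /a [leRHS](@big_cat_nat _ _ _ (p - n.+1))//= ?leq_sub2l// lerDl.
by apply: sumr_ge0 => j _; rewrite divr_ge0// exprn_ge0.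
Qed.

End cesaro_sequence.

(** * The logarithmic series *)

Section log_series.
Context {R : realType}.
Implicit Types s t : R.

(** Each subtracted term has derivative s^j, which leaves the tail s^p/(1-s) of the geometric series
    1/(1-s). *)
Lemma is_derive_ln_remainder p s : s < 1 ->
  is_derive s 1 (fun s => - ln (1 - s) - \sum_(0 <= j < p) s ^+ j.+1 / j.+1%:R)
    (s ^+ p / (1 - s)).
Proof.
move=> s1; have s1_gt0 : 0 < 1 - s by rewrite subr_gt0.
have dsub : is_derive s 1 (fun s => 1 - s) (- 1).
  rewrite (_ : (fun s => 1 - s) = cst 1 - id)//.
  rewrite -[-1]add0r.
  exact: (is_deriveB (is_derive_cst (1 : R) s 1) (is_derive_id s 1)).
have dln : is_derive s 1 (@ln R \o (fun s => 1 - s)) ((1 - s)^-1 * - 1).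
  exact: (@is_derive1_comp _ _ (fun s => 1 - s) _ _ _ (is_derive1_ln s1_gt0) dsub).
elim: p => [|p IHp].
  rewrite (_ : (fun s => _) = - (@ln R \o (fun s => 1 - s))); last first.
    by apply/funext => u; rewrite big_geq// subr0.
  by apply: (is_derive_eq (is_deriveN dln)); rewrite mulrN1 opprK expr0 div1r.
rewrite (_ : (fun s => _) = (fun s => - ln (1 - s) -
    \sum_(0 <= j < p) s ^+ j.+1 / j.+1%:R) -
    (p.+1%:R^-1 : R) \*: (id ^+ p.+1 : R -> R)); last first.
  apply/funext => u; rewrite big_nat_recr//= opprD addrA; congr (_ - _).
  by rewrite mulrC; congr (_ * _); rewrite exprfctE.
apply: (is_derive_eq (is_deriveB IHp (is_deriveZ _ (is_deriveX p.+1 (is_derive_id s 1))))).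
rewrite /= /GRing.scale/= mulr1 mulKf ?pnatr_eq0// exprS.
by field; rewrite gt_eqF.
Qed.

(** The mean value theorem on [0, t] shows that L exceeds the sum by c^p/(1-c) for some 0 < c < t,
    and this increases with c. *)
Lemma ln_series_remainder t p : 0 < t -> t < 1 ->
  let L := t^-1 * ln (1 / (1 - t)) in
  L - t ^+ p / (1 - t) <= \sum_(0 <= j < p) t ^+ j / j.+1%:R <= L.
Proof.
move=> t0 t1; set L := t^-1 * _; set S := \sum_(0 <= j < p) _.
pose f s : R := - ln (1 - s) - \sum_(0 <= j < p) s ^+ j.+1 / j.+1%:R.
have fd s : s < 1 -> is_derive s 1 f (s ^+ p / (1 - s)).
  exact: is_derive_ln_remainder.
have [s||c] := @MVT R f (fun s => s ^+ p / (1 - s)) 0 t t0.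
- by rewrite in_itv/= => /andP[_ st]; apply: fd; exact: lt_trans t1.
- apply: derivable_within_continuous => s; rewrite in_itv/= => /andP[_ st].
  by apply: ex_derive; apply: fd; exact: le_lt_trans t1.
rewrite in_itv/= => /andP[c0 ct].
have f0 : f 0 = 0.
  rewrite /f subr0 ln1 oppr0 add0r big1 ?oppr0// => j _.
  by rewrite expr0n/= mul0r.
have ft : f t = t * (L - S).
  rewrite mulrBr /L mulVKf ?gt_eqF// div1r lnV ?posrE ?subr_gt0// /f.
  by congr (_ - _); rewrite mulr_sumr; apply: eq_bigr => j _; rewrite exprS mulrA.
rewrite f0 ft !subr0 [RHS]mulrC => /(mulfI (lt0r_neq0 t0)) LS.
have c1 : 0 < 1 - c by rewrite subr_gt0 (lt_trans ct).
have r_ge0 : 0 <= c ^+ p / (1 - c) by rewrite divr_ge0 ?exprn_ge0 ?(ltW c0) ?(ltW c1).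
have r_le : c ^+ p / (1 - c) <= t ^+ p / (1 - t).
  apply: ler_pM; rewrite ?exprn_ge0 ?invr_ge0 ?(ltW c0) ?(ltW c1)//.
    by rewrite lerXn2r// ?nnegrE ltW.
  by rewrite lef_pV2 ?posrE ?(subr_gt0 t)// lerD2l lerN2 ltW.
by rewrite lerBlDl -lerBlDr LS r_le -subr_ge0 LS r_ge0.
Qed.

End log_series.

(** * The operator on cs and its norm *)

Section operator_norm.
Context {R : realType} {X : normedModType R[i]}.
Implicit Types (T : X -> X) (M : R).

Lemma opnorm_le T M :
  (forall x, rnorm x <= 1 -> rnorm (T x) <= M) -> opnorm T <= M.
Proof.
move=> TM; apply: ge_sup; first by exists (rnorm (T 0)), 0; rewrite //= rnorm0.
by move=> _ [x x1 <-]; exact: TM.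
Qed.

(** The bound M makes the [sup] a true supremum and not its default value. *)
Lemma ler_opnorm T M x : (forall y, rnorm y <= 1 -> rnorm (T y) <= M) ->
  rnorm x <= 1 -> rnorm (T x) <= opnorm T.
Proof.
move=> TM x1; apply: ub_le_sup; last by exists x.
by exists M => _ [y y1 <-]; exact: TM.
Qed.

Lemma opnorm_ge0 T M : (forall y, rnorm y <= 1 -> rnorm (T y) <= M) ->
  0 <= opnorm T.
Proof.
move=> TM; apply: le_trans (rnorm_ge0 (T 0)) (ler_opnorm TM _).
by rewrite rnorm0.
Qed.

End operator_norm.

Section cs_theory.
Context {R : realType}.
Local Open Scope complex_scope.
Implicit Types (x y : cs R) (M : R).

Lemma cs_ext x y : (forall n, cs_val x n = cs_val y n) -> x = y.
Proof. by move=> xy; apply/val_inj/funext. Qed.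

Lemma cs_valD x y n : cs_val (x + y) n = cs_val x n + cs_val y n.
Proof. by []. Qed.

Lemma cs_valZ (a : R[i]) x n : cs_val (a *: x) n = a *: cs_val x n.
Proof. by []. Qed.

Lemma ler_rnorm_cs x n : rnorm (\sum_(0 <= k < n) cs_val x k) <= rnorm x.
Proof.
by case: n => [|n]; [rewrite big_geq// rnorm0 rnorm_ge0|exact: csnorm_ub].
Qed.

Lemma rnorm_cs_le x M :
  (forall n, rnorm (\sum_(0 <= k < n) cs_val x k) <= M) -> rnorm x <= M.
Proof. by move=> xM; apply: csnorm_le => n. Qed.

Lemma ler_rnorm_cs_val x n : rnorm (cs_val x n) <= 2 * rnorm x.
Proof.
have -> : cs_val x n =
    \sum_(0 <= k < n.+1) cs_val x k - \sum_(0 <= k < n) cs_val x k.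
  by rewrite big_nat_recr//= addrAC subrr add0r.
by rewrite (le_trans (ler_rnormB _ _))// mulr2n mulrDl !mul1r lerD// ler_rnorm_cs.
Qed.

Lemma mem_cs (u : nat -> R[i]^o) (B : R) :
  (forall m p, (m <= p)%N ->
    rnorm (\sum_(m <= k < p) u k) <= B / m.+1%:R) -> u \in @cs_pred R.
Proof.
move=> uB; apply/asboolP; apply: (cvg_complex (B := B)) => m p mp.
by rewrite sub_series_geq ?uB.
Qed.

Lemma cs_delta_subproof m : (fun n => (n == m)%:R : R[i]^o) \in @cs_pred R.
Proof.
apply/asboolP; apply/cvg_ex; exists 1; apply/cvg_rnormP => e e0.
exists m.+1 => // n /= mn.
rewrite /series/= (big_cat_nat (n := m.+1))//= big_nat_recr//= eqxx.
rewrite big_nat big1 ?add0r => [|k /andP[_ km]]; last by rewrite ltn_eqF.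
rewrite big_nat big1 ?addr0 ?subrr ?rnorm0// => k /andP[mk _].
by rewrite gtn_eqF.
Qed.

(** The unit vectors are test vectors: e_0 attains the norm, the e_m exclude a bounded inverse of
    C_t, and e_0 or e_1 stays away from a projective orbit. *)
Definition cs_delta m : cs R := Cs (cs_delta_subproof m).

Lemma rnorm_cs_delta m : rnorm (cs_delta m) = 1.
Proof.
have sumE n : \sum_(0 <= k < n) cs_val (cs_delta m) k = (m < n)%:R.
  elim: n => [|n IHn]; first by rewrite big_geq.
  rewrite big_nat_recr//= {}IHn ltnS.
  by case: ltngtP => _; rewrite ?add0r ?addr0.
apply/eqP; rewrite eq_le; apply/andP; split.
  apply: rnorm_cs_le => n; rewrite sumE.
  by case: (m < n)%N; rewrite ?rnorm0// (@rnormC R 1) normr1.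
rewrite (le_trans _ (ler_rnorm_cs _ m.+1))// sumE ltnSn.
by rewrite (@rnormC R 1) normr1.
Qed.

End cs_theory.

Section cesaro_operator.
Context {R : realType}.
Local Open Scope complex_scope.
Variable t : R.
Hypotheses (t_ge0 : 0 <= t) (t_lt1 : t < 1).
Implicit Types (x y : cs R).

(** Bounded partial sums suffice, so this applies to eigenvectors and solutions not yet known to lie
    in cs. *)
Lemma mem_cs_gen_cesaro (u : nat -> R[i]^o) (A : R) :
  (forall n, rnorm (\sum_(0 <= k < n) u k) <= A) ->
  gen_cesaro t u \in @cs_pred R.
Proof.
by move=> uA; apply: mem_cs => m p mp; apply: gen_cesaro_tail => // n _.
Qed.

Definition cesaro_op x : cs R := Cs (mem_cs_gen_cesaro (ler_rnorm_cs x)).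

Lemma cesaro_val x n : cs_val (cesaro_op x) n =
  (n.+1%:R^-1 : R[i]) *: \sum_(0 <= k < n.+1) t%:C ^+ (n - k) *: cs_val x k.
Proof. by []. Qed.

Lemma cesaro_linear : linear cesaro_op.
Proof.
move=> a x y; apply: cs_ext => n.
rewrite cs_valD cs_valZ !cesaro_val scalerA mulrC -scalerA -scalerDr.
congr (_ *: _); rewrite scaler_sumr -big_split/=; apply: eq_bigr => k _.
rewrite -[LHS]/(_ *: (a *: cs_val x k + cs_val y k)).
by rewrite scalerDr !scalerA mulrC.
Qed.

Lemma rnorm_cesaro_le x (L : R) :
  (forall p, \sum_(0 <= j < p) t ^+ j / j.+1%:R <= L) ->
  rnorm (cesaro_op x) <= L * rnorm x.
Proof.
move=> aL; apply: rnorm_cs_le => n.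
rewrite (le_trans (gen_cesaro_le _ (A := rnorm x) _))// => [k _|].
  exact: ler_rnorm_cs.
by rewrite ler_wpM2r ?rnorm_ge0.
Qed.

Lemma rnorm_cesaro_delta0 p :
  \sum_(0 <= j < p) t ^+ j / j.+1%:R <= rnorm (cesaro_op (cs_delta 0)).
Proof.
rewrite (le_trans _ (ler_rnorm_cs _ p))//.
rewrite (_ : \sum_(0 <= k < p) _ = (\sum_(0 <= j < p) t ^+ j / j.+1%:R)%:C).
  by rewrite rnormC ler_norm.
rewrite rmorph_sum; apply: eq_bigr => j _ /=.
rewrite /gen_cesaro big_nat_recl//= big1 ?addr0 => [|k _]; last first.
  by rewrite scaler0.
rewrite subn0 rmorphM/= rmorphXn/= fmorphV/= rmorph_nat !scaleCE.
by rewrite mulr1 mulrC.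
Qed.

(** The upper bound comes from Abel summation, the lower one from e_0. Leaving L abstract covers t =
    0 and t > 0 together. *)
Lemma opnorm_cesaro (L : R) :
  (fun p => \sum_(0 <= j < p) t ^+ j / j.+1%:R) @ \oo --> L ->
  (forall p, \sum_(0 <= j < p) t ^+ j / j.+1%:R <= L) ->
  opnorm cesaro_op = L.
Proof.
move=> aL a_le.
have L0 : 0 <= L by have := a_le 0%N; rewrite big_geq.
have TL x : rnorm x <= 1 -> rnorm (cesaro_op x) <= L.
  move=> x1; rewrite (le_trans (rnorm_cesaro_le _ a_le))//.
  by rewrite ler_piMr.
apply/eqP; rewrite eq_le (opnorm_le TL) andTb.
have : \forall p \near \oo, \sum_(0 <= j < p) t ^+ j / j.+1%:R <= opnorm cesaro_op.
  apply: nearW => p; rewrite (le_trans (rnorm_cesaro_delta0 p))//.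
  by apply: ler_opnorm TL _; rewrite rnorm_cs_delta.
by move=> /(limr_le (cvgP _ aL)); rewrite (cvg_lim _ aL).
Qed.

End cesaro_operator.

(** * Eigenvectors and resolvent *)

Section cesaro_equation.
Context {R : realType}.
Local Open Scope complex_scope.
Variable t : R.
Hypotheses (t_ge0 : 0 <= t) (t_lt1 : t < 1).
Implicit Types (x y z : nat -> R[i]^o) (l : R[i]).

Lemma gen_cesaro_eq0 x m : (forall k, (k < m)%N -> x k = 0) ->
  forall k, (k < m)%N -> gen_cesaro t x k = 0.
Proof.
move=> x0 k km; rewrite /gen_cesaro big_nat big1 ?scaler0// => j /andP[_ jk].
by rewrite x0 ?scaler0// (leq_trans jk).
Qed.

Lemma gen_cesaro_diag x m : (forall k, (k < m)%N -> x k = 0) ->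
  gen_cesaro t x m = m.+1%:R^-1 * x m.
Proof.
move=> x0; rewrite /gen_cesaro big_nat_recr//= subnn expr0 scale1r.
rewrite big_nat big1 ?add0r// => j /andP[_ jk].
by rewrite x0 ?scaler0.
Qed.

Lemma exists_tail_le (e : R) : 0 < e -> exists m : nat,
  2 / (1 - t) / m.+1%:R <= e.
Proof.
move=> e0; exists (Num.truncn (2 / (1 - t) / e)).
by rewrite ler_pdivrMr// [e * _]mulrC -ler_pdivrMr// ltW ?truncnS_gt.
Qed.

(* The tail of [gen_cesaro t x] past m is dominated by half of [l *: x], so it
   can be absorbed into the left-hand side of the equation. *)
Lemma cesaro_equation_bound l m (B D : R) x y :
  2 / (1 - t) / m.+1%:R <= rnorm (l : R[i]^o) / 2 -> l != 0 ->
  (forall n, l *: x n = y n + gen_cesaro t x n) ->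
  (forall n, rnorm (\sum_(0 <= k < n) y k) <= B) ->
  (forall n, (n <= m)%N -> rnorm (\sum_(0 <= k < n) gen_cesaro t x k) <= D) ->
  forall n, rnorm (\sum_(0 <= k < n) x k) <= 2 * (B + D) / rnorm (l : R[i]^o).
Proof.
move=> lm l0 xyE yB zD; set r := rnorm _ in lm *.
have r0 : 0 < r := @rnorm_gt0 R R[i]^o l l0.
have B0 : 0 <= B by rewrite (le_trans (rnorm_ge0 _) (yB 0%N)).
have D0 : 0 <= D by rewrite (le_trans (rnorm_ge0 _) (zD 0%N _)).
set Q := 2 * _ / r.
have Q0 : 0 <= Q by rewrite divr_ge0 ?mulr_ge0 ?addr_ge0// ltW.
suff H N n : (n <= N)%N -> rnorm (\sum_(0 <= k < n) x k) <= Q.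
  by move=> n; exact: (H n).
elim: N n => [|N IHN] n; first by rewrite leqn0 => /eqP ->; rewrite big_geq// rnorm0.
rewrite leq_eqVlt => /orP[/eqP ->{n}|]; last exact: IHN.
(* If the newest partial sum, of size s, exceeds Q, it is the largest so far, so s can serve as the
   bound in the tail estimate. This gives r s <= B + D + r s / 2, hence s <= Q. *)
set s := rnorm _; have [//|Qs] := leP s Q.
have xs n : (n <= N.+1)%N -> rnorm (\sum_(0 <= k < n) x k) <= s.
  rewrite leq_eqVlt => /orP[/eqP -> //|/IHN nQ].
  by rewrite (le_trans nQ)// ltW.
have zs : rnorm (\sum_(0 <= k < N.+1) gen_cesaro t x k) <= D + r / 2 * s.
  have rs : 0 <= r / 2 * s by rewrite mulr_ge0 ?rnorm_ge0// divr_ge0// ltW.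
  have [Nm|mN] := leqP N.+1 m; first by rewrite (le_trans (zD _ Nm))// lerDl.
  rewrite (big_cat_nat (n := m))//= 1?ltnW//.
  rewrite (le_trans (ler_rnormD _ _))// lerD ?zD//.
  rewrite (le_trans (gen_cesaro_tail t_ge0 t_lt1 xs _)) 1?ltnW//.
  rewrite (_ : 2 * s / _ / _ = 2 / (1 - t) / m.+1%:R * s); last first.
    by rewrite -!mulrA [s * _]mulrC !mulrA.
  by rewrite ler_wpM2r ?rnorm_ge0.
have rsE : r * s <= B + D + r / 2 * s.
  rewrite /s /r -[_ * _]rnormZ scaler_sumr (eq_bigr _ (fun k _ => xyE k)).
  rewrite big_split/= (le_trans (ler_rnormD _ _))// -addrA lerD//.
move: Qs; rewrite /Q ltr_pdivrMr// ltNge => /negP[].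
move: rsE; clearbody s r; clear; lra.
Qed.

(** The eigenvalue equation is the case y = 0 of the bound above: x has bounded partial sums, hence
    x = l^-1 C_t x lies in cs. *)
Lemma mem_cs_eigenvector l x :
  l != 0 -> (forall n, l *: x n = gen_cesaro t x n) -> x \in @cs_pred R.
Proof.
move=> l0 xE; set r := rnorm (l : R[i]^o).
have r0 : 0 < r := @rnorm_gt0 R R[i]^o l l0.
have [m rm] := exists_tail_le (divr_gt0 r0 (ltr0Sn _ 1)).
pose D := \sum_(0 <= n < m.+1) rnorm (\sum_(0 <= k < n) gen_cesaro t x k).
have x0E n : l *: x n = (fun=> 0) n + gen_cesaro t x n by rewrite add0r.
have xB : forall n, rnorm (\sum_(0 <= k < n) x k) <= 2 * (0 + D) / r.
  apply: cesaro_equation_bound rm l0 x0E _ _ => [n|n nm].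
    by rewrite big1// rnorm0.
  rewrite /D [leRHS](@bigD1_seq _ _ _ _ _ n) ?mem_index_iota ?iota_uniq//=.
  by rewrite lerDl sumr_ge0// => j _; exact: rnorm_ge0.
have -> : x = l^-1 *: (gen_cesaro t x : nat -> R[i]^o).
  by apply/funext => n; rewrite -[RHS]/(l^-1 *: _) -xE scalerK.
by rewrite rpredZ// (mem_cs_gen_cesaro t_ge0 t_lt1 xB).
Qed.

(** For n < m the exponent n - m truncates to 0, but the binomial coefficient vanishes. *)
Definition cesaro_eigenseq m : nat -> R[i]^o :=
  fun n => t%:C ^+ (n - m) * 'C(n, m)%:R.

Lemma cesaro_eigenseqE m n :
  (m.+1%:R^-1 : R[i]) *: cesaro_eigenseq m n = gen_cesaro t (cesaro_eigenseq m) n.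
Proof.
have m0 : (m.+1%:R : R[i]) != 0 by rewrite pnatr_eq0.
suff : (fun n => (m.+1%:R^-1 : R[i]) *: cesaro_eigenseq m n) =
  gen_cesaro t (cesaro_eigenseq m) by move=> /(congr1 (@^~ n)).
apply/gen_cesaroP; split=> [|{}n].
  rewrite /cesaro_eigenseq; case: m m0 => [|m] m0; last by rewrite mulr0 scaler0.
  by rewrite invr1 scale1r.
rewrite !scaleCE; set a := cesaro_eigenseq m n; set b := cesaro_eigenseq m n.+1.
(* Absorption identity (n+1-m) binomial(n+1, m) = (n+1) binomial(n, m). For n < m both sides vanish,
   through the factor n+1-m when n+1 = m. *)
have ab : (n.+1%:R - m%:R) * b = t%:C * (n.+1%:R * a).
  rewrite /a /b /cesaro_eigenseq; have [nm|mn] := ltnP n m.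
    rewrite (bin_small nm) !mulr0.
    move: nm; rewrite leq_eqVlt => /predU1P[->|nm]; first by rewrite subrr mul0r.
    by rewrite (bin_small nm) !mulr0.
  rewrite -natrB; last exact: leqW.
  rewrite mulrCA -natrM -mul_bin_down natrM subSn// exprS.
  by rewrite -mulrA; congr (_ * _); rewrite mulrCA.
have -> : n.+2%:R = n.+1%:R - m%:R + m.+1%:R :> R[i].
  by rewrite -addrA -[m.+1%:R]natr1 addKr natr1.
by rewrite mulrCA mulrDl ab mulrDr mulKf// !(mulrCA m.+1%:R^-1).
Qed.

End cesaro_equation.

(** * The equation l x - C_t x = y *)

Section cesaro_equation_solutions.
Context {R : realType}.
Local Open Scope complex_scope.
Variable t : R.
Hypotheses (t_ge0 : 0 <= t) (t_lt1 : t < 1).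
Implicit Types (x y z : nat -> R[i]^o) (l : R[i]).

(** Eliminating x through l x = y + z leaves a recurrence for z = C_t x alone, solvable when no l
    (n+1) - 1 vanishes. *)
Lemma cesaro_equationP l x y z : l != 0 -> (forall n, l * x n = y n + z n) ->
  z = gen_cesaro t x <->
  (l - 1) * z 0%N = y 0%N /\
  forall n, (l * n.+2%:R - 1) * z n.+1 = l * t%:C * n.+1%:R * z n + y n.+1.
Proof.
move=> l0 xyz; split=> [/gen_cesaroP[z0 zS]|[z0 zS]].
  split=> [|n]; first by rewrite mulrBl mul1r {1}z0 xyz addrK.
  rewrite mulrBl mul1r -[l * n.+2%:R * z n.+1]mulrA zS mulrDr xyz addrA addrK.
  by rewrite !mulrA.
apply/gen_cesaroP; split=> [|n]; apply: (mulfI l0).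
  by rewrite xyz -z0 mulrBl mul1r subrK.
by rewrite mulrDr xyz addrA !mulrA -[_ * n.+1%:R]mulrA mulrA -zS mulrBl mul1r subrK.
Qed.

(** Up to index m, C_t x is computed from y by finitely many steps of the recurrence, so D is
    independent of x, y and B. *)
Lemma cesaro_initial_bound l m : l != 0 ->
  (forall n, l * n.+1%:R - 1 != 0) ->
  exists2 D : R, 0 <= D & forall x y (B : R),
    (forall n, l * x n = y n + gen_cesaro t x n) ->
    (forall n, rnorm (\sum_(0 <= k < n) y k) <= B) ->
    forall n, (n <= m)%N -> rnorm (gen_cesaro t x n) <= D * B.
Proof.
move=> l0 ln.
pose r n := rnorm (l * n.+1%:R - 1 : R[i]^o).
have r0 n : 0 < r n := @rnorm_gt0 R R[i]^o _ (ln n).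
have y_le y B n : (forall n, rnorm (\sum_(0 <= k < n) y k) <= B) ->
    rnorm (y n) <= 2 * B.
  move=> yB; have -> : y n = \sum_(0 <= k < n.+1) y k - \sum_(0 <= k < n) y k.
    by rewrite big_nat_recr//= addrAC subrr add0r.
  by rewrite (le_trans (ler_rnormB _ _))// mulr2n mulrDl !mul1r lerD.
elim: m => [|m [D D0 IHm]].
  exists (2 / r 0%N); first by rewrite divr_ge0// ltW.
  move=> x y B xE yB n; rewrite leqn0 => /eqP ->{n}.
  have [/(_ erefl)[z0 _] _] := cesaro_equationP l0 xE.
  rewrite mulrAC ler_pdivlMr// mulrC -rnormM mulr1 z0.
  exact: (y_le y B 0%N yB).
pose c := rnorm (l * t%:C * m.+1%:R : R[i]^o).
have c0 : 0 <= (c * D + 2) / r m.+1.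
  by rewrite divr_ge0 ?(ltW (r0 _)) ?addr_ge0 ?mulr_ge0 ?rnorm_ge0.
exists (D + (c * D + 2) / r m.+1); first by rewrite addr_ge0.
move=> x y B xE yB n.
have B0 : 0 <= B by rewrite (le_trans (rnorm_ge0 _) (yB 0%N)).
have zm := IHm _ _ _ xE yB m (leqnn m).
rewrite mulrDl leq_eqVlt => /orP[/eqP ->{n}|nm]; last first.
  by rewrite (le_trans (IHm _ _ _ xE yB n nm))// lerDl mulr_ge0.
rewrite (@le_trans _ _ ((c * D + 2) / r m.+1 * B)) ?lerDr ?mulr_ge0//.
have [/(_ erefl)[_ zS] _] := cesaro_equationP l0 xE.
rewrite mulrAC ler_pdivlMr// mulrC -rnormM zS.
rewrite (le_trans (ler_rnormD _ _))// mulrDl lerD//; last exact: (y_le y B _ yB).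
by rewrite -[c * D * B]mulrA rnormM -/c ler_wpM2l ?rnorm_ge0.
Qed.

(** The recurrence controls the first m entries and the tail is absorbed. This a priori bound yields
    both membership of x in cs and boundedness of the inverse. *)
Lemma cesaro_resolvent_bound l : l != 0 ->
  (forall n, l * n.+1%:R - 1 != 0) ->
  exists M : R, forall x y (B : R),
    (forall n, l * x n = y n + gen_cesaro t x n) ->
    (forall n, rnorm (\sum_(0 <= k < n) y k) <= B) ->
    forall n, rnorm (\sum_(0 <= k < n) x k) <= M * B.
Proof.
move=> l0 ln; set r := rnorm (l : R[i]^o).
have r0 : 0 < r := @rnorm_gt0 R R[i]^o l l0.
have [m rm] := exists_tail_le t (divr_gt0 r0 (ltr0Sn _ 1)).
have [D D0 zD] := cesaro_initial_bound m l0 ln.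
exists (2 * (1 + m%:R * D) / r) => x y B xE yB n.
have B0 : 0 <= B by rewrite (le_trans (rnorm_ge0 _) (yB 0%N)).
rewrite (le_trans (cesaro_equation_bound (D := m%:R * D * B) t_ge0 t_lt1 rm l0 xE yB _ n))//; last first.
  by rewrite le_eqVlt; apply/orP; left; apply/eqP; field; rewrite gt_eqF.
move=> p pm; rewrite (le_trans (ler_rnorm_sum _ _ _))//.
rewrite (@le_trans _ _ (\sum_(0 <= k < p) D * B))//.
  rewrite big_nat [leRHS]big_nat ler_sum// => k /andP[_ kp].
  by apply: (zD x y B xE yB k); exact: leq_trans (ltnW kp) pm.
rewrite sumr_const_nat subn0 -mulrA mulr_natl.
by rewrite ler_wpMn2l ?mulr_ge0.
Qed.

End cesaro_equation_solutions.

(** * Point spectrum and spectrum *)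

Section cesaro_spectrum.
Context {R : realType}.
Local Open Scope complex_scope.
Variable t : R.
Hypotheses (t_ge0 : 0 <= t) (t_lt1 : t < 1).
Implicit Types (x y : cs R) (l : R[i]).

Let Ct := cesaro_op t_ge0 t_lt1.

Lemma cesaro_resolvent l : l != 0 ->
  (forall n, l * n.+1%:R - 1 != 0) ->
  exists M : R, forall y,
    exists2 x, l *: x - Ct x = y & rnorm x <= M * rnorm y.
Proof.
move=> l0 ln; have [M xM] := cesaro_resolvent_bound t_ge0 t_lt1 l0 ln; exists M => y.
(* [z] is the candidate for C_t x, solved from the recurrence; x is then read off from l x = y +
   z. *)
pose z := fix z n : R[i]^o := if n is n'.+1 then
  (l * n'.+2%:R - 1)^-1 * (l * t%:C * n'.+1%:R * z n' + cs_val y n)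
  else (l - 1)^-1 * cs_val y 0%N.
pose x n : R[i]^o := l^-1 * (cs_val y n + z n).
have xE n : l * x n = cs_val y n + z n by rewrite /x mulVKf.
have zE : z = gen_cesaro t x.
  apply/(cesaro_equationP t l0 xE); split=> [|n] /=.
    by rewrite mulVKf//; have := ln 0%N; rewrite mulr1.
  by rewrite mulVKf.
have {}xE n : l * x n = cs_val y n + gen_cesaro t x n by rewrite -zE.
have xB := xM _ _ _ xE (ler_rnorm_cs y).
have xcs : x \in @cs_pred R.
  have -> : x = l^-1 *: ((cs_val y : nat -> R[i]^o) + gen_cesaro t x).
    by apply/funext => n; rewrite -zE.
  by rewrite rpredZ// rpredD ?(valP y)// (mem_cs_gen_cesaro t_ge0 t_lt1 xB).
exists (Cs xcs); last exact: rnorm_cs_le.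
by apply: cs_ext => n; rewrite -[LHS]/(l * x n - gen_cesaro t x n) xE addrK.
Qed.

Lemma cesaro_point_spectrum : point_spectrum Ct = Lambda R.
Proof.
apply/seteqP; split=> l /=.
  move=> [x x0 xE].
  have [n xn] : exists n, cs_val x n != 0.
    apply: contrapT => /forallNP x0'; move/eqP: x0; apply; apply: cs_ext => n.
    by have /negP := x0' n; rewrite negbK => /eqP.
  (* At the first nonzero coordinate m, triangularity reduces the eigenvalue equation to x_m/(m+1) =
     l x_m. *)
  case: (ex_minnP (ex_intro (fun n => cs_val x n != 0) n xn)) => m xm mP.
  have xlt k : (k < m)%N -> cs_val x k = 0.
    by move=> km; apply: contraTeq km => /mP; rewrite -leqNgt.
  exists m => //; have := congr1 (fun u => cs_val u m) xE.
  rewrite -[LHS]/(gen_cesaro t (cs_val x) m) gen_cesaro_diag//.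
  by move=> /(mulIf xm).
move=> [m _ <-].
have m0 : (m.+1%:R^-1 : R[i]) != 0 by rewrite invr_eq0 pnatr_eq0.
have vcs := mem_cs_eigenvector t_ge0 t_lt1 m0 (cesaro_eigenseqE t m).
exists (Cs vcs); last by apply: cs_ext => n; exact/esym/cesaro_eigenseqE.
apply/eqP => /(congr1 (fun u => cs_val u m)).
rewrite -[LHS]/(cesaro_eigenseq t m m) /cesaro_eigenseq subnn expr0 binn mulr1.
by move/eqP; rewrite oner_eq0.
Qed.

(** C_t x vanishes before m too, so its partial sums are tails. *)
Lemma rnorm_cesaro_op_tail x m : (forall k, (k < m)%N -> cs_val x k = 0) ->
  rnorm (Ct x) <= 2 / (1 - t) / m.+1%:R * rnorm x.
Proof.
move=> x0; have Cx0 := gen_cesaro_eq0 t x0; apply: rnorm_cs_le => n.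
have [nm|mn] := leqP n m.
  rewrite big_nat big1 => [|k /andP[_ kn]]; last exact: Cx0 (leq_trans kn nm).
  by rewrite rnorm0 mulr_ge0 ?rnorm_ge0// !divr_ge0// subr_ge0 ltW.
rewrite (big_cat_nat (n := m))//= 1?ltnW// big_nat big1 => [|k /andP[_ kn]]; last first.
  exact: Cx0.
rewrite add0r (le_trans (gen_cesaro_tail t_ge0 t_lt1 (A := rnorm x) _ _)) 1?ltnW//.
  by move=> k _; exact: ler_rnorm_cs.
rewrite (_ : 2 * _ / _ / _ = 2 / (1 - t) / m.+1%:R * rnorm x)//.
by rewrite -!mulrA [rnorm _ * _]mulrC !mulrA.
Qed.

Lemma cesaro_spectrum : spectrum Ct = Lambda0 R.
Proof.
apply/seteqP; split=> l /=.
  apply: contra_notP => /not_orP[lL /eqP l0].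
  have ln n : l * n.+1%:R - 1 != 0.
    apply: contra_notN lL; rewrite subr_eq0 => /eqP ln; exists n => //.
    have n0 : n.+1%:R != 0 :> R[i] by rewrite pnatr_eq0.
    by apply: (mulIf n0); rewrite mulVf.
  pose L x := l *: x - Ct x.
  have L_lin a x y : L (a *: x + y) = a *: L x + L y.
    rewrite /L [Ct _](cesaro_linear t_ge0 t_lt1) scalerDr scalerBr opprD addrACA !scalerA.
    by rewrite [l * a]mulrC.
  (* Outside [Lambda] there are no eigenvectors. Injectivity makes the right inverse chosen below
     linear and two-sided. *)
  have L_inj : injective L.
    move=> x y Lxy; apply/eqP; rewrite -subr_eq0; apply/negPn/negP => xy0.
    apply: lL; rewrite -cesaro_point_spectrum; exists (x - y) => //.
    apply/esym/eqP; rewrite -subr_eq0 -/(L (x - y)) addrC -scaleN1r L_lin Lxy.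
    by rewrite scaleN1r addNr.
  have [M /choice[S SP]] : exists M, forall y, exists x,
      L x = y /\ rnorm x <= M * rnorm y.
    have [M LM] := cesaro_resolvent l0 ln; exists M => y.
    by have [x xy xM] := LM y; exists x.
  have LS y : L (S y) = y by have [] := SP y.
  exists S; split=> [|x|//]; last by apply: L_inj; rewrite LS.
  split=> [a x y|]; first by apply: L_inj; rewrite L_lin !LS.
  by exists M => y; have [] := SP y.
move=> lL [S [[_ [M SM]] SK _]].
have S0 : S 0 = 0.
  by apply: rnorm_le0; rewrite (le_trans (SM 0))// rnorm0 mulr0.
case: lL => [|l0]; [rewrite -cesaro_point_spectrum => -[x x0 xE]|].
  by move: (SK x); rewrite xE subrr S0 => /esym/eqP; rewrite (negbTE x0).
(* For l = 0, S would send - C_t e_m, of norm at most 1/(|M|+1), to e_m of norm 1, against the bound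
   M. *)
have M0 : 0 < `|M| + 1 by rewrite ltr_wpDl.
have [|m mM] := @exists_tail_le _ t (`|M| + 1)^-1; first by rewrite invr_gt0.
have := SM (l *: cs_delta m - Ct (cs_delta m)).
rewrite SK l0 scale0r sub0r rnormN rnorm_cs_delta; apply/negP; rewrite -ltNge.
have CM : rnorm (Ct (cs_delta m)) <= (`|M| + 1)^-1.
  rewrite (le_trans (rnorm_cesaro_op_tail (m := m) _)) ?rnorm_cs_delta ?mulr1//.
  by move=> k km /=; rewrite ltn_eqF.
rewrite (@le_lt_trans _ _ (`|M| * (`|M| + 1)^-1))//; last first.
  by rewrite ltr_pdivrMr// mul1r ltrDl.
by rewrite (le_trans (ler_wpM2r (rnorm_ge0 _) (ler_norm M)))// ler_wpM2l.
Qed.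

End cesaro_spectrum.

(** * Powers *)

Section cesaro_powers.
Context {R : realType}.
Local Open Scope complex_scope.
Variable t : R.
Hypotheses (t_ge0 : 0 <= t) (t_lt1 : t < 1).
Implicit Types (x y : cs R) (l : R[i]) (m n : nat).

Let Ct := cesaro_op t_ge0 t_lt1.

Let CtL a x y : Ct (a *: x + y) = a *: Ct x + Ct y.
Proof. exact: cesaro_linear. Qed.

Lemma iter_cesaro_linear n : linear (iter n Ct).
Proof. by elim: n => [//|n IHn] a x y; rewrite !iterS IHn CtL. Qed.

Lemma iter_cesaro_eq0 n x m : (forall k, (k < m)%N -> cs_val x k = 0) ->
  forall k, (k < m)%N -> cs_val (iter n Ct x) k = 0.
Proof. by move=> x0; elim: n => [//|n IHn]; exact: gen_cesaro_eq0. Qed.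

Lemma mem_cs_eigenseq m : cesaro_eigenseq t m \in @cs_pred R.
Proof.
have m0 : (m.+1%:R^-1 : R[i]) != 0 by rewrite invr_eq0 pnatr_eq0.
exact: (mem_cs_eigenvector t_ge0 t_lt1 m0 (cesaro_eigenseqE t m)).
Qed.

Let v m : cs R := Cs (mem_cs_eigenseq m).

Let iter_v n m : iter n Ct (v m) = (m.+1%:R^-1 : R[i]) ^+ n *: v m.
Proof.
have Cv : Ct (v m) = (m.+1%:R^-1 : R[i]) *: v m.
  by apply: cs_ext => k; exact/esym/cesaro_eigenseqE.
have CtZ a x : Ct (a *: x) = a *: Ct x.
  have Ct0 : Ct 0 = 0.
    by have := CtL (- 1) 0 0; rewrite scaler0 addr0 scaleN1r addNr.
  by have := CtL a x 0; rewrite Ct0 !addr0.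
elim: n => [|n IHn]; first by rewrite scale1r.
by rewrite iterS IHn CtZ Cv scalerA exprSr.
Qed.

(** As [v m] vanishes before m and equals 1 at m, this removes coordinate m and keeps the earlier
    ones. *)
Let rest m x := x - cs_val x m *: v m.

Let rest_eq0 m x : (forall k, (k < m)%N -> cs_val x k = 0) ->
  forall k, (k < m.+1)%N -> cs_val (rest m x) k = 0.
Proof.
move=> x0 k; rewrite ltnS leq_eqVlt => /predU1P[->|km].
  rewrite -[LHS]/(cs_val x m - cs_val x m * cesaro_eigenseq t m m).
  by rewrite /cesaro_eigenseq subnn binn mulr1 mulr1 subrr.
rewrite -[LHS]/(cs_val x k - cs_val x m * cesaro_eigenseq t m k) x0// sub0r.
by rewrite /cesaro_eigenseq bin_small// !mulr0 oppr0.
Qed.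

Let rnorm_rest m x : rnorm (rest m x) <= (1 + 2 * rnorm (v m)) * rnorm x.
Proof.
rewrite (le_trans (ler_rnormB _ _))// mulrDl mul1r lerD2l rnormZ.
by rewrite mulrAC ler_wpM2r ?rnorm_ge0 ?ler_rnorm_cs_val.
Qed.

Let iter_rest n m x :
  iter n Ct x = ((m.+1%:R^-1 : R[i]) ^+ n * cs_val x m) *: v m + iter n Ct (rest m x).
Proof.
rewrite mulrC -scalerA -iter_v -iter_cesaro_linear; congr (iter n Ct _).
by rewrite /rest addrC subrK.
Qed.

(* On the invariant subspace of the sequences vanishing before m, C_t has
   spectral radius 1/(m+1); splitting off the eigenvectors v_m one by one
   reduces to a large m, for which C_t itself has norm at most 1/2. *)
Lemma iter_cesaro_decay m : (0 < m)%N -> exists2 K : R, 0 <= K &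
  forall x n, (forall k, (k < m)%N -> cs_val x k = 0) ->
    rnorm (iter n Ct x) <= K * 2^-1 ^+ n * rnorm x.
Proof.
have [|N hN] := @exists_tail_le _ t (2^-1 : R); first by rewrite invr_gt0.
(* Downward induction on m, phrased as induction on d with [N <= m + d]. *)
move: {2}N (leq_addl m N) => d; elim: d m => [|d IHd] m.
  rewrite addn0 => Nm m0; exists 1 => // x n x0; rewrite mul1r.
  have tK : 0 <= 2 / (1 - t) by rewrite divr_ge0// subr_ge0 ltW.
  have hm : 2 / (1 - t) / m.+1%:R <= 2^-1.
    by rewrite (le_trans _ hN)// ler_wpM2l// lef_pV2 ?posrE// ler_nat.
  elim: n => [|n IHn]; first by rewrite mul1r.
  rewrite iterS (le_trans (rnorm_cesaro_op_tail t_ge0 t_lt1 (m := m) _))//.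
    exact: iter_cesaro_eq0.
  by rewrite exprS -[leRHS]mulrA ler_pM ?rnorm_ge0// mulr_ge0.
rewrite addnS -addSn => /IHd/(_ isT)[K K0 xK] m0.
exists (2 * rnorm (v m) + K * (1 + 2 * rnorm (v m))).
  by rewrite ?(addr_ge0, mulr_ge0, rnorm_ge0).
move=> x n x0; rewrite (iter_rest n m) (le_trans (ler_rnormD _ _))// !mulrDl lerD//.
  have p0 : 0 <= (2^-1 : R) ^+ n by rewrite exprn_ge0.
  (* Since 0 < m, the eigenvalue 1/(m+1) is at most 1/2. *)
  have mn : rnorm ((m.+1%:R^-1 : R[i]) ^+ n : R[i]^o) <= 2^-1 ^+ n.
    have -> : (m.+1%:R^-1 : R[i]) ^+ n = (m.+1%:R^-1 ^+ n : R)%:C.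
      by rewrite rmorphXn/= fmorphV/= rmorph_nat.
    rewrite rnormC ger0_norm ?exprn_ge0// lerXn2r// ?nnegrE//.
    by rewrite lef_pV2 ?posrE// ler_nat ltnS.
  rewrite rnormZ -[complex.Re _]/(rnorm (_ : R[i]^o)) rnormM.
  rewrite [leRHS](_ : _ = 2^-1 ^+ n * (2 * rnorm x) * rnorm (v m)); last by ring.
  by rewrite ler_wpM2r ?rnorm_ge0// ler_pM ?rnorm_ge0// ler_rnorm_cs_val.
rewrite (le_trans (xK _ _ (rest_eq0 x0)))//.
rewrite [leRHS](_ : _ =
  K * 2^-1 ^+ n * ((1 + 2 * rnorm (v m)) * rnorm x)); last by ring.
by rewrite ler_wpM2l ?rnorm_rest// mulr_ge0// exprn_ge0.
Qed.

(** [v 0] is (t^k)_k, with eigenvalue 1; once it is split off, the decay for m = 1 applies to the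
    remainder. *)
Lemma iter_cesaro_cvg : exists2 K : R, 0 <= K & forall x n,
  rnorm (iter n Ct x - cs_val x 0%N *: v 0) <= K * 2^-1 ^+ n * rnorm x.
Proof.
have [K K0 xK] := iter_cesaro_decay (ltn0Sn 0).
exists (K * (1 + 2 * rnorm (v 0))).
  by rewrite ?(addr_ge0, mulr_ge0, rnorm_ge0).
move=> x n; rewrite (iter_rest n 0) invr1 expr1n mul1r addrAC subrr add0r.
rewrite (le_trans (xK _ _ (rest_eq0 _)))//.
rewrite [leRHS](_ : _ =
  K * 2^-1 ^+ n * ((1 + 2 * rnorm (v 0)) * rnorm x)); last by ring.
by rewrite ler_wpM2l ?rnorm_rest// mulr_ge0// exprn_ge0.
Qed.

End cesaro_powers.

Lemma dense_rnorm (R : realType) (X : normedModType R[i]) (S : set X) (x : X) (e : R) :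
  dense S -> 0 < e -> exists2 y, S y & rnorm (x - y) < e.
Proof.
move=> dS e0.
have eC : 0 < e%:C%C by rewrite ltcR.
have [|y [xy Sy]] := dS (ball x e%:C%C) _ (ball_open x e%:C%C).
  by exists x; exact: ballxx.
by exists y => //; move: xy; rewrite -ball_normE/= -rnormE ltcR.
Qed.

(** * Power boundedness, mean ergodicity, supercyclicity *)

Section cesaro_dynamics.
Context {R : realType}.
Local Open Scope complex_scope.
Variable t : R.
Hypotheses (t_ge0 : 0 <= t) (t_lt1 : t < 1).
Implicit Types (x y : cs R) (m n : nat).

Let Ct := cesaro_op t_ge0 t_lt1.
Let v : cs R := Cs (mem_cs_eigenseq t_ge0 t_lt1 0).

Lemma iter_cesaro_bounded : exists2 M : R, 0 <= M & forall x n,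
  rnorm (iter n Ct x) <= M * rnorm x.
Proof.
have [K K0 xK] := iter_cesaro_cvg t_ge0 t_lt1.
exists (K + 2 * rnorm v) => [|x n]; first by rewrite ?(addr_ge0, mulr_ge0, rnorm_ge0).
rewrite -[iter n Ct x](subrK (cs_val x 0%N *: v)) (le_trans (ler_rnormD _ _))//.
rewrite mulrDl lerD//; last first.
  by rewrite rnormZ mulrAC ler_wpM2r ?rnorm_ge0// ler_rnorm_cs_val.
rewrite (le_trans (xK x n))// ler_wpM2r ?rnorm_ge0// ler_piMr//.
by rewrite exprn_ile1 ?invr_ge0// invf_le1 ?ler1n ?ltr0n.
Qed.

Lemma cesaro_power_bounded : power_bounded Ct.
Proof.
have [M M0 xM] := iter_cesaro_bounded; exists M => _ [n _ <-].
by apply: opnorm_le => x x1; rewrite (le_trans (xM x n))// ler_piMr.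
Qed.

Lemma cesaro_uniformly_mean_ergodic : uniformly_mean_ergodic Ct.
Proof.
have [K K0 xK] := iter_cesaro_cvg t_ge0 t_lt1.
exists (fun x => cs_val x 0%N *: v).
  split=> [a x y|]; first by rewrite -[LHS]/((a *: cs_val x 0%N + cs_val y 0%N) *: v) scalerDl scalerA.
  exists (2 * rnorm v) => x.
  by rewrite rnormZ mulrAC ler_wpM2r ?rnorm_ge0// ler_rnorm_cs_val.
(* The errors K 2^-m, m = 1, ..., n, sum to at most K, so the means are within K/n of the
   projection. *)
have geo n : \sum_(1 <= m < n.+1) (2^-1 : R) ^+ m <= 1.
  suff -> : \sum_(1 <= m < n.+1) (2^-1 : R) ^+ m = 1 - 2^-1 ^+ n.
    by rewrite lerBlDr lerDl exprn_ge0.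
  elim: n => [|n IHn]; first by rewrite big_geq// subrr.
  by rewrite big_nat_recr//= IHn exprS; field.
have le_opnorm n x : (0 < n)%N -> rnorm x <= 1 ->
    rnorm (ergodic_mean Ct n x - cs_val x 0%N *: v) <= K / n%:R.
  move=> n0 x1.
  have nz : (n%:R : R[i]) != 0 by rewrite pnatr_eq0 -lt0n.
  have -> : ergodic_mean Ct n x - cs_val x 0%N *: v = (n%:R^-1 : R)%:C *:
      \sum_(1 <= m < n.+1) (iter m Ct x - cs_val x 0%N *: v).
    rewrite sumrB scalerBr fmorphV/= rmorph_nat sumr_const_nat subSS subn0.
    by rewrite -[(_ *: v) *+ _]scaler_nat scalerK.
  rewrite rnormZC ger0_norm ?invr_ge0// mulrC ler_wpM2r ?invr_ge0//.
  rewrite (le_trans (ler_rnorm_sum _ _ _))//.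
  rewrite (@le_trans _ _ (\sum_(1 <= m < n.+1) K * 2^-1 ^+ m))//.
    apply: ler_sum => m _; rewrite (le_trans (xK x m))// ler_piMr//.
    by rewrite mulr_ge0// exprn_ge0.
  by rewrite -mulr_sumr ler_piMr.
apply/cvgrPdist_lt => e e0; exists (Num.truncn (K / e)).+1 => // n /= Kn.
have n0 : (0 < n)%N by exact: leq_trans Kn.
rewrite sub0r normrN ger0_norm; last exact: opnorm_ge0 (fun x => le_opnorm n x n0).
rewrite (le_lt_trans (opnorm_le (fun x => le_opnorm n x n0)))//.
rewrite ltr_pdivrMr ?ltr0n// [e * _]mulrC -ltr_pdivrMr//.
by rewrite (lt_le_trans (truncnS_gt _))// ler_nat.
Qed.

Lemma cesaro_not_supercyclic : ~ supercyclic Ct.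
Proof.
move=> [x xdense].
have iter0 n : cs_val (iter n Ct x) 0%N = cs_val x 0%N.
  elim: n => [//|n IHn].
  by rewrite -[LHS]/(gen_cesaro t (iter n Ct x) 0%N) gen_cesaro_diag// invr1 mul1r.
have [M M0 xM] := iter_cesaro_bounded.
(* If x_0 = 0, the projective orbit vanishes at coordinate 0 and stays at distance at least 1/2 from
   e_0. *)
have [x0|x0] := eqVneq (cs_val x 0%N) 0.
  have [|_ [l _ [n _ <-]]] := dense_rnorm (cs_delta 0) xdense (_ : 0 < 2^-1).
    by rewrite invr_gt0.
  apply/negP; rewrite -leNgt.
  have := ler_rnorm_cs_val (cs_delta 0 - l *: iter n Ct x) 0%N.
  rewrite -[X in rnorm X <= _]/(1 - l * cs_val (iter n Ct x) 0%N).
  by rewrite iter0 x0 mulr0 subr0 (rnormC 1) normr1; lra.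
(* C_t fixes the coordinate 0 and has bounded orbits, so every y in the projective
   orbit of x satisfies |y_1| <= (B / r) |y_0|: the orbit stays away from e_1. *)
set r := rnorm (cs_val x 0%N).
have r0 : 0 < r := rnorm_gt0 x0.
pose B := 2 * (M * rnorm x).
have B0 : 0 <= B by rewrite !mulr_ge0// rnorm_ge0.
have c0 : 0 < 1 + B / r by rewrite ltr_wpDr// divr_ge0// ltW.
(* The estimates |l| r <= 2 d and 1 <= 2 d + |l| B below give 1 <= 2 d (1 + B/r), that is d >= e. *)
pose e := (2 * (1 + B / r))^-1.
have e0 : 0 < e by rewrite invr_gt0 mulr_gt0.
have [_ [l _ [n _ <-]]] := dense_rnorm (cs_delta 1) xdense e0.
set d := rnorm _ => de.
have d_le k := ler_rnorm_cs_val (cs_delta 1 - l *: iter n Ct x) k.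
have lr : rnorm (l : R[i]^o) * r <= 2 * d.
  rewrite -rnormM -(iter0 n) -rnormN.
  by have := d_le 0%N; rewrite -[X in rnorm X <= _]/(0 - l * _) sub0r.
have lB : 1 <= 2 * d + rnorm (l : R[i]^o) * B.
  have xB : rnorm (cs_val (iter n Ct x) 1%N) <= B.
    by rewrite (le_trans (ler_rnorm_cs_val _ _))// ler_wpM2l.
  have : rnorm (1 : R[i]^o) <= rnorm ((1 : R[i]^o) - l * cs_val (iter n Ct x) 1%N)
      + rnorm (l * cs_val (iter n Ct x) 1%N : R[i]^o).
    by rewrite -[X in rnorm X <= _](subrK (l * cs_val (iter n Ct x) 1%N)) ler_rnormD.
  rewrite (rnormC 1) normr1 rnormM => /le_trans; apply; rewrite lerD//.
    exact: d_le 1%N.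
  by rewrite ler_wpM2l ?rnorm_ge0.
move: de; apply/negP; rewrite -leNgt /e -[leLHS]mul1r ler_pdivrMr ?mulr_gt0//.
rewrite (le_trans lB)// [leRHS](_ : _ = 2 * d + 2 * d * (B / r)); last by ring.
rewrite lerD2l.
have -> : rnorm (l : R[i]^o) * B = rnorm (l : R[i]^o) * r * (B / r).
  by field; rewrite gt_eqF.
by rewrite ler_wpM2r// divr_ge0// ltW.
Qed.

End cesaro_dynamics.

(** * Compactness *)

Section cs_compactness.
Context {R : realType}.
Local Open Scope complex_scope.

(** Complex sequences are encoded as sequences of pairs of reals under the product topology, so that
    Tychonoff's theorem applies to products of squares; [c] decodes them. *)
Let P := prod_topology (fun _ : nat => (R * R)%type).
Let c (u : P) (k : nat) : R[i]^o := ((u k).1 +i* (u k).2)%C.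
Implicit Types (u w : P) (B e : R) (m p N : nat).

Let near_prefix u N e : 0 < e ->
  \forall w \near u, forall k, (k < N)%N -> rnorm (c u k - c w k) <= e.
Proof.
move=> e0; elim: N => [|N IHN]; first exact: (@filterE _ (nbhs u) (nbhs_filter u)).
have e20 : 0 < e / 2 by rewrite divr_gt0.
have : \forall w \near u, ball (u N) (e / 2) (w N).
  exact: (@proj_continuous nat (fun=> (R * R)%type) N u _ (nbhsx_ballx (u N) _ e20)).
move: IHN; apply: filterS2 => w uw [/= uw1 uw2] k.
rewrite ltnS leq_eqVlt => /predU1P[->|]; last exact: uw.
rewrite (le_trans (ler_rnorm_ReIm _))// [e]splitr lerD// ltW//.
Qed.

Let near_sum u p e : 0 < e ->
  \forall w \near u, forall m n, (n <= p)%N ->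
    rnorm (\sum_(m <= k < n) c u k - \sum_(m <= k < n) c w k) <= e.
Proof.
move=> e0; have e0' : 0 < e / p.+1%:R by rewrite divr_gt0.
apply: filterS (near_prefix u p e0') => w uw m n np.
rewrite -sumrB (le_trans (ler_rnorm_sum _ _ _))//.
rewrite (@le_trans _ _ (\sum_(m <= k < n) (e / p.+1%:R)))//.
  rewrite big_nat [leRHS]big_nat ler_sum// => k /andP[_ kn].
  by rewrite uw// (leq_trans kn).
rewrite sumr_const_nat -[_ *+ (n - m)]mulr_natr mulrAC ler_pdivrMr// ler_wpM2l ?(ltW e0)//.
by rewrite ler_nat (leq_trans (leq_subr _ _))// (leq_trans np).
Qed.

Let K B : set P := [set u | forall m p, (m <= p)%N ->
  rnorm (\sum_(m <= k < p) c u k) <= B / m.+1%:R].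

(** Each condition defining [K B] involves finitely many coordinates, so it passes to limits. *)
Let K_closed B : closed (K B).
Proof.
move=> u uK m p mp; apply/ler_addgt0Pr => e e0.
have [w [wK uw]] := uK _ (near_sum u p e0).
rewrite -[X in rnorm X](subrK (\sum_(m <= k < p) c w k)) addrC.
by rewrite (le_trans (ler_rnormD _ _))// lerD ?wK ?uw.
Qed.

(** The condition with p = m+1 bounds each coordinate by B, so [K B] is closed in a product of
    squares. *)
Let K_compact B : compact (K B).
Proof.
apply: (@subclosed_compact P _
    [set u | forall k, (`[- B, B] `*` `[- B, B]) (u k)]); first exact: K_closed.
- apply: (@tychonoff nat (fun=> (R * R)%type) (fun=> `[- B, B] `*` `[- B, B])) => k.
  by apply: compact_setX; exact: segment_compact.
- move=> u uK k; have : rnorm (c u k) <= B.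
    have B0 : 0 <= B.
      by have := uK 0%N 0%N (leqnn _); rewrite divr1; exact/le_trans/rnorm_ge0.
    have := uK k k.+1 (leqnSn k); rewrite big_nat1 => /le_trans; apply.
    by rewrite ler_pdivrMr// ler_peMr// ler1n.
  move=> cB; split; rewrite /= in_itv/= -ler_norml.
    exact: le_trans (ler_Re_rnorm (c u k)) cB.
  exact: le_trans (ler_Im_rnorm (c u k)) cB.
Qed.

Let f u : cs R := insubd 0 (c u).

Let fE B u : K B u -> cs_val (f u) = c u.
Proof. by move=> uK; rewrite /f -[cs_val _]/(val _) insubdK// (mem_cs uK). Qed.

Let f_continuous B : {within K B, continuous f}.
Proof.
apply/subspace_continuousP => u uK; apply/cvg_rnormP => e e0.
have B0 : 0 <= B.
  by have := uK 0%N 0%N (leqnn _); rewrite divr1; exact/le_trans/rnorm_ge0.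
have e30 : 0 < e / 4 by rewrite divr_gt0.
(* Beyond N the two tails contribute e/4 each, the first N terms another e/4. *)
have [N BN] : exists N, B / N.+1%:R <= e / 4.
  exists (Num.truncn (B / (e / 4))).
  by rewrite ler_pdivrMr// [e / 4 * _]mulrC -ler_pdivrMr// ltW ?truncnS_gt.
apply: filterS (near_sum u N e30) => w uw wK.
have fuw k : cs_val (f u - f w) k = c u k - c w k.
  by rewrite -(fE uK) -(fE wK).
rewrite (@le_lt_trans _ _ (3 * (e / 4)))//; last by lra.
apply: rnorm_cs_le => n.
rewrite (eq_bigr _ (fun k _ => fuw k)) sumrB; have [nN|Nn] := leqP n N.
  by rewrite (le_trans (uw _ _ nN))//; lra.
rewrite !(@big_cat_nat _ _ _ N 0 n)//= 1?ltnW// opprD addrACA.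
rewrite (le_trans (ler_rnormD _ _))// (le_trans (lerD (uw _ _ (leqnn N)) (ler_rnormB _ _)))//.
have -> : 3 * (e / 4) = e / 4 + (e / 4 + e / 4) by ring.
by rewrite lerD2l lerD// (le_trans _ BN) ?uK ?wK// ltnW.
Qed.

(* On sequences with uniformly small tails the cs topology is that of
   coordinatewise convergence, so Tychonoff's theorem applies. *)
Lemma precompact_cs_tail (B : R) : precompact [set x : cs R |
  forall m p, (m <= p)%N -> rnorm (\sum_(m <= k < p) cs_val x k) <= B / m.+1%:R].
Proof.
apply: (@precompact_subset _ _ (f @` K B)); last first.
  apply: compact_precompact; first exact: norm_hausdorff.
  exact: continuous_compact (@f_continuous B) (@K_compact B).
move=> x xB; pose u : P := fun k => (complex.Re (cs_val x k), complex.Im (cs_val x k)).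
have cu : c u = cs_val x by apply/funext => k; rewrite /c /=; case: (cs_val x k).
have uK : K B u by move=> m p mp; rewrite cu xB.
by exists u => //; apply/val_inj; rewrite /= (fE uK) cu.
Qed.

End cs_compactness.

(** The tail estimate puts the image of the unit ball in a set of sequences with uniformly small
    tails. *)
Lemma cesaro_compact (R : realType) (t : R) (t_ge0 : 0 <= t) (t_lt1 : t < 1) :
  compact_operator (cesaro_op t_ge0 t_lt1).
Proof.
split; first exact: cesaro_linear.
apply: precompact_subset (@precompact_cs_tail R (2 * 1 / (1 - t))).
move=> _ [x x1 <-] m p mp; apply: gen_cesaro_tail => // n _.
exact: le_trans (ler_rnorm_cs x n) x1.
Qed.

Lemma cvg_ln_series (R : realType) (t : R) : 0 < t -> t < 1 ->
  (\sum_(0 <= j < p) t ^+ j / j.+1%:R) @[p --> \oo] --> t^-1 * ln (1 / (1 - t)).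
Proof.
move=> t0 t1; set L := t^-1 * _.
apply: (@squeeze_cvgr _ _ _ _ (fun p => L - t ^+ p / (1 - t)) (cst L)).
- by apply: nearW => p; exact: ln_series_remainder.
- rewrite -[X in _ --> X]subr0 -(mul0r (1 - t)^-1).
  apply: cvgB; first exact: cvg_cst.
  by apply: cvgMl; apply: cvg_expr; rewrite ger0_norm// ltW.
- exact: cvg_cst.
Qed.

Theorem proposition6p1 (R : realType) (t : R) (ht0 : 0 <= t) (ht1 : t < 1) :
  exists2 Ct : cs R -> cs R,
    forall x : cs R, cs_val (Ct x) = gen_cesaro t (cs_val x) &
    (t = 0 -> opnorm Ct = 1) /\
    (0 < t -> opnorm Ct = t^-1 * ln (1 / (1 - t))) /\
    bounded_operator Ct /\
    compact_operator Ct /\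
    point_spectrum Ct = Lambda R /\
    spectrum Ct = Lambda0 R /\
    power_bounded Ct /\
    uniformly_mean_ergodic Ct /\
    ~ supercyclic Ct.
Proof.
exists (cesaro_op ht0 ht1) => //.
split=> [t0|]; [|split=> [t_gt0|]].
(* At t = 0 only j = 0 contributes, as 0^0 = 1; the empty sum at p = 0 is the exception. *)
- have sumE p : (0 < p)%N -> \sum_(0 <= j < p) t ^+ j / j.+1%:R = 1.
    case: p => // p _; rewrite big_nat_recl//= big1 ?addr0 ?divr1//.
    by move=> j _; rewrite t0 expr0n/= mul0r.
  apply: opnorm_cesaro => [|[|p]]; [|by rewrite big_geq|by rewrite sumE].
  by apply: cvg_near_cst; exists 1%N => // p /= p0; rewrite sumE.
- apply: opnorm_cesaro => [|p]; first exact: cvg_ln_series.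
  by case/andP: (ln_series_remainder p t_gt0 ht1).
split; first split; first exact: cesaro_linear.
  by have [M _ xM] := iter_cesaro_bounded ht0 ht1; exists M => x; exact: (xM x 1%N).
split; first exact: cesaro_compact.
split; first exact: cesaro_point_spectrum.
split; first exact: cesaro_spectrum.
split; first exact: cesaro_power_bounded.
split; first exact: cesaro_uniformly_mean_ergodic.
exact: cesaro_not_supercyclic.
Qed.
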